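(* Let $n>10^{(10^{13})}$ be the least counterexample to Robin's inequality, i.e. the least integer $n>5040$ with $\sigma(n)\ge e^{\gamma} n\log\log n$ (assuming it exists). Write $n=\prod_{i=1}^r p_i^{a_i}$, where $p_i$ is the $i$-th prime and $p_r$ is the largest prime divisor of $n$. Let $s$ be the largest index $\le r$ such that $a_s\ne 1$. Then $p_s>0.999999\sqrt{p_r}$.
   Context: $\sigma(n)=\sum_{d\mid n} d$, $\gamma$ is the Euler–Mascheroni constant, $\log$ is the natural logarithm. *)

(* Defs.v *)
From Stdlib Require Import Reals.
From Coquelicot Require Import Coquelicot.
From mathcomp Require Import all_boot.

Definition sigma (n : nat) : nat := (\sum_(d <- divisors n) d)%N.

Definition harmonic_minus_log (N : nat) : R :=
  Rminus (sum_f_R0 (fun k => Rinv (INR (k + 1))) N) (ln (INR (N + 1))).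
Definition euler_gamma : R := real (Lim_seq harmonic_minus_log).

Definition robin_fails (n : nat) : Prop :=
  Rge (INR (sigma n)) (Rmult (Rmult (exp euler_gamma) (INR n)) (ln (ln (INR n)))).

(* p is the i-th prime (1-indexed: p_1 = 2, p_2 = 3, ...) *)
Definition is_nth_prime (i p : nat) : Prop :=
  prime p /\ count prime (iota 0 p.+1) = i.

Definition largest_prime_divisor (n p : nat) : Prop :=
  prime p /\ (p %| n)%N /\ (forall q, prime q -> (q %| n)%N -> (q <= p)%N).

(* Main.v *)
Require Import Defs.
From Stdlib Require Import Reals Lra.
From Coquelicot Require Import Coquelicot.
From mathcomp Require Import all_boot zify.

(** Let [n] be the least counterexample, [N = ln n] and [L = N ln N].  For
    [5040 < m < n], Robin's inequality holds at [m] and fails at [n]; by concavity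
    of [ln] this gives [(sigma m / m) / (sigma n / n) < 1 - ln (n / m) / L], whatever
    the value of [exp gamma].

    Taking [m = n / p] yields [p ^ a * ln p < L] for the exponent [a] of [p] in [n].
    Hence only primes below [sqrt (2 L)] can have exponent at least 2, and [N] is at
    most [theta p_r] up to a negligible error; Chebyshev's bound then gives
    [N <= 1.15 p_r].  If [p_s < sqrt p_r], Chebyshev's bounds also provide a prime [q]
    with [sqrt p_r < q <= 1.29 sqrt p_r], whose exponent is 1, as is that of [p_r].
    With [m = n q / p_r] the inequality above becomes
    [1 / p_r - 1 / (q (q + 1)) > ln (p_r / q) / L] up to lower-order terms.  The left
    side is at most about [0.40 / p_r], but [ln (p_r / q)] is about [(ln p_r) / 2], so
    the right side is at least [0.42 / p_r]. *)

Local Notation sigma := Defs.sigma.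
Local Open Scope nat_scope.

(** * Chebyshev's quotient *)

Definition primorial (M : nat) : nat := \prod_(p < M.+1 | prime p) p.

Lemma primorial_gt0 M : 0 < primorial M.
Proof. by apply: prodn_cond_gt0 => i; apply: prime_gt0. Qed.

Lemma big_ord_recr_cond K (P : pred nat) (F : nat -> nat) :
  \prod_(q < K.+1 | P q) F q = (\prod_(q < K | P q) F q) * (if P K then F K else 1).
Proof. by rewrite big_mkcond big_ord_recr /= [in RHS]big_mkcond. Qed.

Lemma logn_prod_primes p K (e : nat -> nat) : prime p ->
  logn p (\prod_(q < K | prime q) q ^ e q) = if p < K then e p else 0.
Proof.
move=> p_pr; elim: K => [|K IH]; first by rewrite big_ord0 logn1.
rewrite (big_ord_recr_cond K prime (fun q => q ^ e q)) /=.
have P0 : 0 < \prod_(q < K | prime q) q ^ e q.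
  by apply: prodn_cond_gt0 => i pi; rewrite expn_gt0 prime_gt0.
case: ifP => K_pr.
  rewrite lognM ?expn_gt0 ?(prime_gt0 K_pr) // IH lognX logn_prime // ltnS.
  case: (ltngtP p K) => [lt|lt|->]; lia.
rewrite muln1 IH ltnS; case: (ltngtP p K) => // pK.
by move: K_pr; rewrite -pK p_pr.
Qed.

Lemma logn_primorial p M : prime p -> logn p (primorial M) = (p <= M).
Proof.
move=> p_pr; have -> : primorial M = \prod_(q < M.+1 | prime q) q ^ 1.
  by apply: eq_bigr => q _; rewrite expn1.
by rewrite (logn_prod_primes _ _ (fun=> 1)) // ltnS; case: leqP.
Qed.

Lemma logn_nonprime p n : ~~ prime p -> logn p n = 0.
Proof. by move=> np; rewrite lognE (negbTE np). Qed.

Lemma dvdn_from_log m n : 0 < m -> 0 < n ->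
  (forall p, prime p -> logn p m <= logn p n) -> m %| n.
Proof.
move=> m0 n0 le_log; rewrite -(_ : lcmn m n = n) ?dvdn_lcml //.
apply: eqn_from_log => // [|p /=]; first by rewrite lcmn_gt0 m0.
rewrite logn_lcm //; case: (boolP (prime p)) => [/le_log /maxn_idPr //|np].
by rewrite !logn_nonprime.
Qed.

(** There are at most [K] primes up to [K], and each gives one factor [B]. *)
Lemma prod_if_leq K B M :
  0 < B -> \prod_(q < M | prime q) (if q <= K then B else 1) <= B ^ K.
Proof.
(* The exponent must grow with [M] for the induction; [M.-1] is enough because 0 is not prime. *)
move=> B0; suff : \prod_(q < M | prime q) (if q <= K then B else 1) <= B ^ minn M.-1 K.
  by move/leq_trans; apply; rewrite leq_pexp2l // geq_minr.
elim: M => [|M IH]; first by rewrite big_ord0 expn_gt0 B0.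
rewrite (big_ord_recr_cond M prime (fun q => if q <= K then B else 1)) /=.
case: ifP => M_pr; last first.
  rewrite muln1; apply: leq_trans IH _; rewrite leq_pexp2l //; lia.
have := prime_gt0 M_pr => M0.
case: (leqP M K) => MK.
  apply: (@leq_trans (B ^ minn M.-1 K * B)); first by rewrite leq_mul.
  by rewrite -expnSr leq_pexp2l //; lia.
by rewrite muln1; apply: leq_trans IH _; rewrite leq_pexp2l //; lia.
Qed.

(** Primes above [K] contribute at most a primorial, and each of the at most [K] remaining primes at
    most [B]. This serves both for Chebyshev's quotient and for the least counterexample. *)
Lemma leq_primorial_mul_exp n P K B : 0 < n -> 0 < B ->
  (forall p, prime p -> p %| n -> p <= P) ->
  (forall p, prime p -> p ^ logn p n <= B) ->
  (forall p, prime p -> K < p -> logn p n <= 1) ->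
  n <= primorial P * B ^ K.
Proof.
move=> n0 B0 n_le n_pow n_sqf.
have -> : n = \prod_(q < P.+1 | prime q) q ^ logn q n.
  apply: eqn_from_log => //.
    by apply: prodn_cond_gt0 => i pi; rewrite expn_gt0 prime_gt0.
  move=> p; case: (boolP (prime p)) => [p_pr|np]; last by rewrite !logn_nonprime.
  rewrite (logn_prod_primes _ _ (fun q => logn q n)) // ltnS.
  case: leqP => // ltPp; apply/eqP; rewrite -leqn0 leqNgt logn_gt0 mem_primes p_pr n0 /=.
  by apply/negP => /(n_le _ p_pr); rewrite leqNgt ltPp.
apply: (@leq_trans (\prod_(q < P.+1 | prime q) (q * (if q <= K then B else 1)))).
  apply: leq_prod => q q_pr; case: (leqP q K) => qK.
    by apply: leq_trans (n_pow _ q_pr) _; rewrite leq_pmull // prime_gt0.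
  by rewrite muln1 -[X in _ <= X]expn1 leq_pexp2l ?prime_gt0 // n_sqf.
by rewrite big_split /= leq_mul2l prod_if_leq // orbT.
Qed.

(** Legendre's formula padded with zero terms, so that valuations of several factorials can be
    combined term by term over one range. *)
Lemma logn_fact_widen p m K : prime p -> m < K ->
  logn p m`! = \sum_(1 <= k < K) m %/ p ^ k.
Proof.
move=> p_pr ltmK; rewrite logn_fact // (big_cat_nat (n := m.+1) (p := K)) //=.
rewrite [X in _ + X]big_nat_cond [X in _ + X]big1 ?addn0 // => k.
rewrite andbT => /andP[ltmk _]; apply: divn_small.
by apply: ltn_trans ltmk _; rewrite ltn_expl // prime_gt1.
Qed.

(** Since 1 + 1/30 = 1/2 + 1/3 + 1/5, the terms of order [M ln M] cancel in the logarithm of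
    [cheb_num M] over [cheb_den M]. *)
Definition cheb_num M := M`! * (M %/ 30)`!.
Definition cheb_den M := (M %/ 2)`! * (M %/ 3)`! * (M %/ 5)`!.

(* An integer whose valuation at a prime [p] is the sum over [k >= 1] of
   [cheb_step (M %/ p ^ k)], with [cheb_step] taking only the values 0 and 1. *)
Definition cheb M := cheb_num M %/ cheb_den M.

Definition cheb_step y := y + y %/ 30 - (y %/ 2 + y %/ 3 + y %/ 5).

Lemma cheb_num_gt0 M : 0 < cheb_num M.
Proof. by rewrite muln_gt0 !fact_gt0. Qed.

Lemma cheb_den_gt0 M : 0 < cheb_den M.
Proof. by rewrite !muln_gt0 !fact_gt0. Qed.

Lemma logn_cheb_num p M : prime p -> logn p (cheb_num M) =
  \sum_(1 <= k < M.+1) (M %/ p ^ k + M %/ p ^ k %/ 30).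
Proof.
move=> p_pr; rewrite lognM ?fact_gt0 // !(@logn_fact_widen p _ M.+1) ?ltnS ?leq_div //.
by rewrite big_split /=; congr (_ + _); apply: eq_bigr => k _; rewrite divnAC.
Qed.

Lemma logn_cheb_den p M : prime p -> logn p (cheb_den M) =
  \sum_(1 <= k < M.+1) (M %/ p ^ k %/ 2 + M %/ p ^ k %/ 3 + M %/ p ^ k %/ 5).
Proof.
move=> p_pr; rewrite !lognM ?muln_gt0 ?fact_gt0 //.
rewrite !(@logn_fact_widen p _ M.+1) ?ltnS ?leq_div //.
by rewrite !big_split /=; congr (_ + _ + _); apply: eq_bigr => k _; rewrite divnAC.
Qed.

Lemma cheb_den_dvd M : cheb_den M %| cheb_num M.
Proof.
apply: dvdn_from_log; rewrite ?cheb_num_gt0 ?cheb_den_gt0 // => p p_pr.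
rewrite logn_cheb_num // logn_cheb_den //; apply: leq_sum => k _; lia.
Qed.

Lemma cheb_mul_den M : cheb M * cheb_den M = cheb_num M.
Proof. exact: divnK (cheb_den_dvd M). Qed.

Lemma cheb_gt0 M : 0 < cheb M.
Proof. by rewrite divn_gt0 ?cheb_den_gt0 // dvdn_leq ?cheb_num_gt0 ?cheb_den_dvd. Qed.

Lemma logn_cheb p M : prime p ->
  logn p (cheb M) = \sum_(1 <= k < M.+1) cheb_step (M %/ p ^ k).
Proof.
move=> p_pr; rewrite logn_div ?cheb_den_dvd // logn_cheb_num // logn_cheb_den //.
by rewrite -sumnB // => k _; lia.
Qed.

(** Every term of the valuation is at most 1, and the terms with [k > t] vanish because [p ^ k]
    exceeds [M]. *)
Lemma logn_cheb_le p M t : prime p -> M < p ^ t.+1 -> logn p (cheb M) <= t.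
Proof.
move=> p_pr ltM; rewrite logn_cheb //.
apply: (@leq_trans (\sum_(1 <= k < M.+1) (k < t.+1))).
  apply: leq_sum => k _; rewrite /cheb_step; case: (ltnP k t.+1) => kt; first by lia.
  rewrite divn_small //; apply: leq_trans ltM _.
  by rewrite leq_pexp2l ?prime_gt0.
suff -> : forall m, \sum_(1 <= k < m.+1) (k < t.+1) = minn m t by rewrite geq_minr.
elim=> [|m IH]; first by rewrite big_geq // min0n.
by rewrite big_nat_recr //= IH; case: ltnP; lia.
Qed.

(** By [logn_cheb_le], prime powers in [cheb M] are at most [M], and primes above [K] occur at most
    once. This yields the lower bound for [theta]. *)
Lemma cheb_le_primorial M K : 0 < M -> M < K.+1 ^ 2 ->
  cheb M <= primorial M * M ^ K.
Proof.
move=> M0 ltMK; apply: leq_primorial_mul_exp => //; first exact: cheb_gt0.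
- move=> p p_pr; rewrite leqNgt => p_dvd; apply/negP => ltMp.
  have := @logn_cheb_le p M 0 p_pr; rewrite expn1 => /(_ ltMp).
  by rewrite leqNgt logn_gt0 mem_primes p_pr cheb_gt0 p_dvd.
- move=> p p_pr; apply: leq_trans (trunc_logP (prime_gt1 p_pr) M0).
  rewrite leq_pexp2l ?prime_gt0 //; apply: logn_cheb_le => //.
  by apply: trunc_log_ltn; apply: prime_gt1.
- move=> p p_pr ltKp; apply: logn_cheb_le => //; apply: leq_trans ltMK _.
  by rewrite leq_exp2r.
Qed.

(** A prime [p] with [M %/ 6 < p <= M] has [M %/ p] between 1 and 5, where [cheb_step] equals 1, so
    it divides [cheb M]. Iteration yields the upper bound for [theta]. *)
Lemma primorial_le_cheb M : primorial M <= primorial (M %/ 6) * cheb M.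
Proof.
apply: dvdn_leq; first by rewrite muln_gt0 primorial_gt0 cheb_gt0.
apply: dvdn_from_log; rewrite ?muln_gt0 ?primorial_gt0 ?cheb_gt0 // => p p_pr.
rewrite lognM ?primorial_gt0 ?cheb_gt0 // !logn_primorial // logn_cheb //.
case: (leqP p M) => // pM; case: (leqP p (M %/ 6)) => // p6.
have p0 := prime_gt0 p_pr.
rewrite big_ltn ?ltnS ?(leq_trans p0 pM) // expn1 add0n.
suff -> : cheb_step (M %/ p) = 1 by exact: leq_addr.
have h1 : 0 < M %/ p by rewrite divn_gt0.
have h2 : M %/ p < 6 by rewrite ltn_divLR // mulnC -ltn_divLR.
rewrite /cheb_step; lia.
Qed.

Lemma primorialS M : primorial M.+1 = primorial M * (if prime M.+1 then M.+1 else 1).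
Proof. exact: (big_ord_recr_cond M.+1 prime id). Qed.

Lemma primorial_le_fact M : primorial M <= M`!.
Proof.
elim: M => [|M IH]; first by rewrite /primorial big_mkcond big_ord_recr big_ord0.
by rewrite primorialS factS mulnC leq_mul //; case: ifP.
Qed.

Lemma primorial_eq x y : x <= y ->
  (forall q, prime q -> x < q -> y < q) -> primorial y = primorial x.
Proof.
move=> le_xy no_primes; apply: eqn_from_log; rewrite ?primorial_gt0 // => p.
case: (boolP (prime p)) => [p_pr|np]; last by rewrite !logn_nonprime.
rewrite !logn_primorial //; have := no_primes p p_pr.
by case: (leqP p x) => [px _|xp /(_ isT) yp]; lia.
Qed.

(** * The divisor sum *)

Lemma sigma_codivisors n : 0 < n -> sigma n = \sum_(d <- divisors n) n %/ d.
Proof.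
move=> n0; have divK d : d \in divisors n -> n %/ (n %/ d) = d.
  by rewrite -dvdn_divisors // => dn; rewrite divnA // mulKn.
have perm : perm_eq (divisors n) (map (divn n) (divisors n)).
  apply: uniq_perm; first exact: divisors_uniq.
    rewrite map_inj_in_uniq ?divisors_uniq // => x y /divK xK /divK yK E.
    by rewrite -xK E yK.
  move=> d; apply/idP/mapP => [dn|[c cn ->]].
    by exists (n %/ d); rewrite ?divK // -dvdn_divisors // dvdn_div // dvdn_divisors.
  by rewrite -dvdn_divisors // dvdn_div // dvdn_divisors.
by rewrite {1}/sigma (perm_big _ perm) big_map.
Qed.

(** Each dyadic block from [2 ^ i] to [2 ^ i.+1] has [2 ^ i] terms, none above [n %/ 2 ^ i], hence
    sum at most [n]. *)
Lemma sum_divn_dyadic n j : \sum_(1 <= i < 2 ^ j) n %/ i <= j * n.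
Proof.
elim: j => [|j IH]; first by rewrite big_geq.
rewrite (big_cat_nat (n := 2 ^ j)) ?expn_gt0 ?leq_pexp2l //= mulSn addnC leq_add //.
apply: (@leq_trans (\sum_(2 ^ j <= i < 2 ^ j.+1) n %/ 2 ^ j)).
  rewrite big_nat_cond [X in _ <= X]big_nat_cond; apply: leq_sum => i.
  by rewrite andbT => /andP[le_i _]; rewrite leq_div2l ?expn_gt0.
by rewrite sum_nat_const_nat expnS mul2n -addnn addnK mulnC leq_divM.
Qed.

Lemma sigma_le_log n j : 0 < n -> n < 2 ^ j -> sigma n <= j * n.
Proof.
move=> n0 ltn; rewrite sigma_codivisors //; apply: leq_trans (sum_divn_dyadic n j).
have perm : perm_eq (divisors n) [seq d <- index_iota 1 (2 ^ j) | d %| n].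
  apply: uniq_perm; rewrite ?divisors_uniq ?filter_uniq ?iota_uniq // => d.
  rewrite -dvdn_divisors // mem_filter mem_index_iota andbC.
  case: (boolP (d %| n)) => [dn|]; last by rewrite andbF.
  by rewrite (dvdn_gt0 n0 dn) (leq_ltn_trans (dvdn_leq n0 dn)).
rewrite (perm_big _ perm) big_filter big_mkcond /=.
by apply: leq_sum => i _; case: ifP.
Qed.

Lemma sigma_gt0 n : 0 < n -> 0 < sigma n.
Proof.
move=> n0; rewrite /sigma (big_rem 1) ?divisor1 //=.
Qed.

(** The divisors of [m * p ^ a.+1] that are multiples of [p] are [p] times the divisors of
    [m * p ^ a]; the others are the divisors of [m]. *)
Lemma sigma_mul_expS m p a : prime p -> 0 < m -> ~~ (p %| m) ->
  sigma (m * p ^ a.+1) = p * sigma (m * p ^ a) + sigma m.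
Proof.
move=> p_pr m0 pm; have p0 := prime_gt0 p_pr.
have pa0 b : 0 < m * p ^ b by rewrite muln_gt0 m0 expn_gt0 p0.
have mulpI : injective (muln p).
  by move=> x y /eqP; rewrite eqn_pmul2l // => /eqP.
have perm : perm_eq (divisors (m * p ^ a.+1))
    (map (muln p) (divisors (m * p ^ a)) ++ divisors m).
  apply: uniq_perm; first exact: divisors_uniq.
    rewrite cat_uniq map_inj_uniq // !divisors_uniq andbT /=.
    apply/hasPn => d; rewrite -dvdn_divisors // => dm.
    apply/mapP => -[c _ dE]; case/negP: pm; apply: dvdn_trans dm.
    by rewrite dE dvdn_mulr.
  move=> d; rewrite mem_cat -!dvdn_divisors //.
  have [pd|pd] := boolP (p %| d).
    have/negbTE -> : ~~ (d %| m) by apply: contra pm; apply: dvdn_trans.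
    rewrite orbF; case/dvdnP: pd => c ->; rewrite [c * p]mulnC mem_map //.
    by rewrite -dvdn_divisors // expnS mulnCA dvdn_pmul2l.
  have/negbTE -> : d \notin map (muln p) (divisors (m * p ^ a)).
    by apply/mapP => -[c _ dE]; rewrite dE dvdn_mulr in pd.
  by rewrite Gauss_dvdl // coprimeXr // coprime_sym prime_coprime.
by rewrite /sigma (perm_big _ perm) big_cat big_map -big_distrr.
Qed.

Lemma sigma_mul_prime m p : prime p -> 0 < m -> ~~ (p %| m) ->
  sigma (m * p) = p.+1 * sigma m.
Proof.
move=> p_pr m0 pm; have := @sigma_mul_expS m p 0 p_pr m0 pm.
by rewrite expn0 expn1 muln1 mulSn addnC.
Qed.

Lemma sigma_mul_prime2 m p : prime p -> 0 < m -> ~~ (p %| m) ->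
  sigma (m * p ^ 2) = (p ^ 2 + p + 1) * sigma m.
Proof.
move=> p_pr m0 pm; rewrite sigma_mul_expS // expn1 sigma_mul_prime //; lia.
Qed.

Lemma sigma_mul_exp_ge m p a : prime p -> 0 < m -> ~~ (p %| m) ->
  p ^ a * sigma m <= sigma (m * p ^ a).
Proof.
move=> p_pr m0 pm; elim: a => [|a IH]; first by rewrite expn0 mul1n muln1.
rewrite sigma_mul_expS // expnS -mulnA; apply: leq_trans (leq_addr _ _).
by rewrite leq_mul2l IH orbT.
Qed.

(** Passing from [n] to [n %/ p] divides [sigma n / n] by at most [1 + 1 / p ^ a], where [a] is the
    exponent of [p] in [n]. *)
Lemma sigma_div_prime n p : prime p -> 0 < n -> p %| n ->
  p ^ logn p n * sigma n <= (p ^ logn p n).+1 * (p * sigma (n %/ p)).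
Proof.
move=> p_pr n0 pn; have p0 := prime_gt0 p_pr.
have : 0 < logn p n by rewrite logn_gt0 mem_primes p_pr n0.
case E : (logn p n) => [//|a] _.
have [m pm nE] := pfactor_coprime p_pr n0; rewrite E in nE.
have m0 : 0 < m by move: n0; rewrite nE muln_gt0 => /andP[].
have pm' : ~~ (p %| m) by rewrite -prime_coprime.
have -> : n %/ p = m * p ^ a by rewrite nE expnSr mulnA mulnK.
rewrite nE sigma_mul_expS // mulSn mulnDr addnC leq_add2r expnS -mulnA.
by rewrite leq_mul2l sigma_mul_exp_ge // orbT.
Qed.

Local Open Scope R_scope.

(** * Explicit bounds for theta *)

Lemma leq_INR m n : (m <= n)%N -> INR m <= INR n.
Proof. by move=> /leP; apply: le_INR. Qed.

Lemma ltn_INR m n : (m < n)%N -> INR m < INR n.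
Proof. by move=> /ltP; apply: lt_INR. Qed.

Lemma INR_muln m n : INR (m * n)%N = INR m * INR n.
Proof. exact: mult_INR. Qed.

Lemma INR_expn m k : INR (m ^ k)%N = INR m ^ k.
Proof. by elim: k => [|k IH] //; rewrite expnS INR_muln IH. Qed.

Lemma INR_gt0 n : (0 < n)%N -> 0 < INR n.
Proof. exact: ltn_INR. Qed.

Lemma ln_le_INR m n : (0 < m)%N -> (m <= n)%N -> ln (INR m) <= ln (INR n).
Proof. by move=> m0 mn; apply: ln_le; [exact: INR_gt0 | exact: leq_INR]. Qed.

Lemma ln_INR_muln m n : (0 < m)%N -> (0 < n)%N ->
  ln (INR (m * n)%N) = ln (INR m) + ln (INR n).
Proof. by move=> m0 n0; rewrite INR_muln ln_mult //; apply: INR_gt0. Qed.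

(** * Elementary inequalities for [ln] and [exp] *)

Lemma ln_tangent a x : 0 < a -> 0 < x -> ln x <= ln a + (x - a) / a.
Proof.
intros Ha Hx.
replace x with (a * (x / a)) at 1 by (field; lra).
assert (H : 0 < x / a) by now apply Rdiv_lt_0_compat.
rewrite (ln_mult _ _ Ha H).
assert (H1 := exp_ineq1_le (ln (x / a))).
rewrite (exp_ln _ H) in H1.
replace ((x - a) / a) with (x / a - 1) by (field; lra).
lra.
Qed.

Lemma exp_INR_mul n x : exp (INR n * x) = exp x ^ n.
Proof.
elim: n => [|n IH]; first by rewrite Rmult_0_l exp_0.
by rewrite S_INR Rmult_plus_distr_r Rmult_1_l exp_plus IH Rmult_comm.
Qed.

(** Together with [exp_le_pow], this brackets [exp (n / k)] by rational powers and so reduces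
    numerical bounds to integer comparisons. *)
Lemma pow_le_exp k n : 0 < k -> (1 + / k) ^ n <= exp (INR n / k).
Proof.
move=> k0; rewrite /Rdiv exp_INR_mul; apply: pow_incr; split; last exact: exp_ineq1_le.
by have := Rinv_0_lt_compat _ k0; lra.
Qed.

Lemma exp_le_pow k n : 1 < k -> exp (INR n / k) <= (k / (k - 1)) ^ n.
Proof.
move=> k1; rewrite /Rdiv exp_INR_mul; apply: pow_incr; split; first exact/Rlt_le/exp_pos.
have k1' : 0 < 1 - / k.
  have : / k < 1 by rewrite -Rinv_1; apply: Rinv_lt_contravar; lra.
  lra.
replace (k * / (k - 1)) with (/ (1 - / k)) by (field; lra).
have -> : exp (/ k) = / exp (- / k) by rewrite exp_Ropp Rinv_inv.
by apply: Rinv_le_contravar => //; exact: exp_ineq1_le.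
Qed.

Lemma inv_exp7_le : / exp 7 <= / 700.
Proof.
apply Rinv_le_contravar; [lra|].
apply Rle_trans with ((1 + / 8) ^ 56); [lra|].
have -> : exp 7 = exp (INR 56 / 8) by congr exp; rewrite INR_IZR_INZ /=; lra.
apply pow_le_exp; lra.
Qed.

(* [ln x] lies below its tangent at [exp 7]. *)
Lemma ln_le_linear x : 0 < x -> ln x <= x / 700 + 6.
Proof.
intros Hx; assert (H := ln_tangent _ _ (exp_pos 7) Hx).
rewrite ln_exp in H.
replace ((x - exp 7) / exp 7) with (x * / exp 7 - 1) in H.
- assert (H7 := inv_exp7_le); nra.
- field; apply Rgt_not_eq, exp_pos.
Qed.

(** An antiderivative of [ln], the main part of [ln] of a factorial. *)
Definition stirling x := x * ln x - x.

Lemma ln_fact_ge m : stirling (INR m) <= ln (INR m`!).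
Proof.
rewrite /stirling; elim: m => [|m IH]; first by rewrite fact0 /= ln_1; lra.
rewrite factS ln_INR_muln ?fact_gt0 // S_INR.
case: (posnP m) IH => [-> _|m0 IH].
  by rewrite fact0 /= Rplus_0_l ln_1; lra.
have m0' := INR_gt0 _ m0.
have H := @ln_tangent (INR m) (INR m + 1) m0' ltac:(lra).
have : INR m * ln (INR m + 1) <= INR m * ln (INR m) + 1.
  replace (INR m * ln (INR m) + 1) with (INR m * (ln (INR m) + (INR m + 1 - INR m) / INR m)).
    by apply: Rmult_le_compat_l; lra.
  by field; lra.
lra.
Qed.

Lemma ln_fact_le m : (0 < m)%N -> ln (INR m`!) <= stirling (INR m) + ln (INR m) + 1.
Proof.
rewrite /stirling; elim: m => [//|[|m] IH _]; first by rewrite factS fact0 /= ln_1; lra.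
have {}IH := IH isT; have m0' := INR_gt0 m.+1 isT.
rewrite factS ln_INR_muln ?fact_gt0 // (S_INR m.+1).
set x := INR m.+1 in IH m0' *.
have H := @ln_tangent (x + 1) x ltac:(lra) m0'.
have : (x + 1) * ln x <= (x + 1) * ln (x + 1) - 1.
  replace ((x + 1) * ln (x + 1) - 1) with ((x + 1) * (ln (x + 1) + (x - (x + 1)) / (x + 1))).
    by apply: Rmult_le_compat_l; lra.
  by field; lra.
lra.
Qed.

(** Tangents to [ln] at [m] and at [x] show that replacing the integer part by [x] costs at most
    [ln x]. *)
Lemma ln_fact_floor m x : (0 < m)%N -> INR m <= x < INR m + 1 ->
  stirling x - ln x <= ln (INR m`!) <= stirling x + ln x + 1.
Proof.
move=> m0 [mx xm]; have m1 : 1 <= INR m by apply: (leq_INR 1 m).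
have ge := ln_fact_ge m; have le := ln_fact_le m m0; rewrite /stirling in ge le *.
have lm0 : 0 <= ln (INR m) by rewrite -ln_1; apply: ln_le; lra.
have lmx : ln (INR m) <= ln x by apply: ln_le; lra.
have H1 := @ln_tangent (INR m) x ltac:(lra) ltac:(lra).
have H2 := @ln_tangent x (INR m) ltac:(lra) ltac:(lra).
have {}H1 : INR m * ln x <= INR m * ln (INR m) + (x - INR m).
  replace (INR m * ln (INR m) + (x - INR m)) with (INR m * (ln (INR m) + (x - INR m) / INR m)).
    by apply: Rmult_le_compat_l; lra.
  by field; lra.
have {}H2 : x * ln (INR m) <= x * ln x + (INR m - x).
  replace (x * ln x + (INR m - x)) with (x * (ln x + (INR m - x) / x)).
    by apply: Rmult_le_compat_l; lra.
  by field; lra.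
split; first by nra.
have : 0 <= (x - INR m) * ln (INR m) by apply: Rmult_le_pos; lra.
lra.
Qed.

Lemma INR_divn_floor M k : (0 < k)%N ->
  INR (M %/ k) <= INR M / INR k < INR (M %/ k) + 1.
Proof.
move=> k0; have k0' := INR_gt0 _ k0.
have lo : INR (M %/ k) * INR k <= INR M by rewrite -INR_muln; apply: leq_INR; exact: leq_divM.
have hi : INR M < (INR (M %/ k) + 1) * INR k.
  by rewrite -S_INR -INR_muln; apply: ltn_INR; exact: ltn_ceil.
by split; [apply: Rmult_le_reg_r k0' _ | apply: Rmult_lt_reg_r k0' _];
  rewrite /Rdiv Rmult_assoc Rinv_l ?Rmult_1_r //; lra.
Qed.

Lemma ln_fact_divn M k : (0 < k <= M)%N ->
  stirling (INR M / INR k) - ln (INR M / INR k) <= ln (INR (M %/ k)`!) <=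
  stirling (INR M / INR k) + ln (INR M / INR k) + 1.
Proof.
by case/andP=> k0 kM; apply: ln_fact_floor; [rewrite divn_gt0 | apply: INR_divn_floor].
Qed.

(** Chebyshev's constant ln 2 / 2 + ln 3 / 3 + ln 5 / 5 - ln 30 / 30, about 0.9213. *)
Definition cheb_const := (14 * ln 2 + 9 * ln 3 + 5 * ln 5) / 30.

Lemma cheb_const_bounds : 91 / 100 <= cheb_const <= 93 / 100.
Proof.
have X : 14 * ln 2 + 9 * ln 3 + 5 * ln 5 = ln (2 ^ 14 * (3 ^ 9 * 5 ^ 5)).
  rewrite ln_mult; try lra; rewrite ln_mult; try lra.
  by rewrite !ln_pow; try lra; rewrite !INR_IZR_INZ /=; lra.
(* [1748 / 64] is just above 27.3 = 30 * 0.91, and [1785 / 64] below is just under 27.9 = 30 *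
   0.93. *)
have lo : INR 1748 / 64 <= ln (2 ^ 14 * (3 ^ 9 * 5 ^ 5)).
  rewrite -(ln_exp (INR 1748 / 64)); apply: ln_le; first exact: exp_pos.
  apply: Rle_trans (exp_le_pow 64 1748 ltac:(lra)) _.
  have -> : 64 - 1 = 63 by lra.
  rewrite /Rdiv Rpow_mult_distr pow_inv.
  apply: (Rmult_le_reg_r (63 ^ 1748)); first by apply: pow_lt; lra.
  rewrite Rmult_assoc Rinv_l ?Rmult_1_r; last by apply: pow_nonzero; lra.
  by rewrite !pow_IZR -!mult_IZR; apply/IZR_le/Z.leb_le; vm_compute.
have hi : ln (2 ^ 14 * (3 ^ 9 * 5 ^ 5)) <= INR 1785 / 64.
  rewrite -(ln_exp (INR 1785 / 64)); apply: ln_le; first by lra.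
  apply: Rle_trans (pow_le_exp 64 1785 ltac:(lra)).
  have -> : 1 + / 64 = 65 * / 64 by lra.
  rewrite Rpow_mult_distr pow_inv.
  apply: (Rmult_le_reg_r (64 ^ 1785)); first by apply: pow_lt; lra.
  rewrite [X in _ <= X]Rmult_assoc Rinv_l ?Rmult_1_r; last by apply: pow_nonzero; lra.
  by rewrite !pow_IZR -!mult_IZR; apply/IZR_le/Z.leb_le; vm_compute.
have lo' : INR 1748 = 1748 by rewrite INR_IZR_INZ; congr IZR.
have hi' : INR 1785 = 1785 by rewrite INR_IZR_INZ; congr IZR.
rewrite /cheb_const X; rewrite {}lo' in lo; rewrite {}hi' in hi.
move: (ln _) lo hi => l lo hi; lra.
Qed.

Definition theta M := ln (INR (primorial M)).

(** After cancellation of the [M ln M] and linear terms, [cheb_const * M] remains; each of the five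
    factorials adds an error of at most [ln M + 1]. *)
Lemma ln_cheb M : (30 <= M)%N ->
  cheb_const * INR M - 5 * ln (INR M) - 5 <= ln (INR (cheb M)) <=
  cheb_const * INR M + 5 * ln (INR M) + 5.
Proof.
move=> M30; have M0 : 0 < INR M by apply: INR_gt0; lia.
have E : ln (INR (cheb M)) + (ln (INR (M %/ 2)`!) + ln (INR (M %/ 3)`!) + ln (INR (M %/ 5)`!))
    = ln (INR M`!) + ln (INR (M %/ 30)`!).
  by rewrite -!ln_INR_muln ?muln_gt0 ?fact_gt0 ?cheb_gt0 // (cheb_mul_den M).
have := @ln_fact_divn M 1 ltac:(lia); have := @ln_fact_divn M 2 ltac:(lia).
have := @ln_fact_divn M 3 ltac:(lia); have := @ln_fact_divn M 5 ltac:(lia).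
have := @ln_fact_divn M 30 ltac:(lia); rewrite divn1.
have -> : INR 30 = 2 * (3 * 5) by simpl; lra.
have -> : INR 5 = 5 by simpl; lra.
have -> : INR 3 = 3 by simpl; lra.
have -> : INR 2 = 2 by [].
have -> : INR 1 = 1 by [].
rewrite /stirling !ln_div ?ln_mult ?ln_1; try lra.
have l2 : 0 <= ln 2 by rewrite -ln_1; apply: ln_le; lra.
have l3 : 0 <= ln 3 by rewrite -ln_1; apply: ln_le; lra.
have l5 : 0 <= ln 5 by rewrite -ln_1; apply: ln_le; lra.
have lM : 0 <= ln (INR M) by rewrite -ln_1; apply: ln_le; [lra | apply: (leq_INR 1 M); lia].
rewrite /cheb_const; lra.
Qed.

Lemma ln_fact_le_self m : (0 < m)%N -> ln (INR m`!) <= INR m * ln (INR m).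
Proof.
elim: m => [//|[|m] IH _]; first by rewrite factS fact0 /= ln_1; lra.
have {}IH := IH isT; rewrite factS ln_INR_muln ?fact_gt0 //.
have h : ln (INR m.+1) <= ln (INR m.+2) by apply: ln_le_INR.
have h1 := INR_gt0 m.+1 isT.
rewrite (S_INR m.+1) in h *; nra.
Qed.

(** Descent from [M] to [M %/ 6] sums a geometric series: 6/5 * 0.93 < 1.13. Below 30,
    [theta M <= M ln M <= 30 ln M]. *)
Lemma theta_le M : (0 < M)%N -> theta M <= 113 / 100 * INR M + 37 * ln (INR M) + 200.
Proof.
elim/ltn_ind: M => M IH M0.
have M1 : 1 <= INR M by apply: (leq_INR 1 M).
have lM : 0 <= ln (INR M) by rewrite -ln_1; apply: ln_le; lra.
case: (ltnP M 30) => M30.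
  have H1 : theta M <= ln (INR M`!).
    by apply: ln_le_INR; [exact: primorial_gt0 | exact: primorial_le_fact].
  have H2 := ln_fact_le_self _ M0.
  have H3 : INR M <= 30 by replace 30 with (INR 30) by (simpl; lra); apply: leq_INR; lia.
  have H4 := ln_le_linear _ (Rlt_le_trans _ _ _ Rlt_0_1 M1).
  nra.
have H1 : theta M <= theta (M %/ 6) + ln (INR (cheb M)).
  rewrite /theta -ln_INR_muln ?primorial_gt0 ?cheb_gt0 //.
  by apply: ln_le_INR; [exact: primorial_gt0 | exact: primorial_le_cheb].
have [_ H2] := ln_cheb _ M30; have [_ A] := cheb_const_bounds.
have M6 : (0 < M %/ 6)%N by rewrite divn_gt0 //; lia.
have H3 := IH (M %/ 6)%N ltac:(rewrite ltn_Pdiv //; lia) M6.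
have [H4 _] := INR_divn_floor M 6 isT.
have E6 : INR 6 = 6 by simpl; lra.
rewrite E6 in H4.
(* The 1 gained here, multiplied by 37, and the slack in the linear coefficient pay for the error
   [5 ln M + 5] of [ln_cheb]. *)
have H5 : ln (INR (M %/ 6)) <= ln (INR M) - 1.
  apply: Rle_trans (_ : ln (INR M / 6) <= _).
    by apply: ln_le => //; apply: INR_gt0.
  rewrite ln_div; try lra.
  have : 1 <= ln 6; last by lra.
  rewrite -(ln_exp 1); apply: ln_le; first exact: exp_pos.
  have := exp_le_3; lra.
have H6 := ln_le_linear _ (Rlt_le_trans _ _ _ Rlt_0_1 M1).
nra.
Qed.

Lemma theta_ge M : (30 <= M)%N ->
  91 / 100 * INR M - 5 * ln (INR M) - 5 - sqrt (INR M) * ln (INR M) <= theta M.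
Proof.
move=> M30; have [A _] := cheb_const_bounds; have [H _] := ln_cheb _ M30.
have M1 : 1 <= INR M by apply: (leq_INR 1 M); lia.
have lM : 0 <= ln (INR M) by rewrite -ln_1; apply: ln_le; lra.
have [K1 K2] := Nat.sqrt_spec M ltac:(lia).
set K := Nat.sqrt M in K1 K2.
have H1 : ln (INR (cheb M)) <= theta M + INR K * ln (INR M).
  rewrite -ln_pow; last by lra.
  rewrite -INR_expn -ln_INR_muln ?primorial_gt0 ?expn_gt0 ?(leq_trans _ M30) //.
  apply: ln_le_INR; first exact: cheb_gt0.
  by apply: cheb_le_primorial; [lia | rewrite -mulnn; lia].
have H2 : INR K <= sqrt (INR M).
  rewrite -(sqrt_square (INR K)); last exact: pos_INR.
  by apply: sqrt_le_1_alt; rewrite -mult_INR; apply: le_INR.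
nra.
Qed.

(** Without such a prime [theta x = theta y], but 0.91 * 1.28 > 1.13, with a margin that covers the
    lower-order terms at this size. *)
Lemma exists_prime_between x y : (3000000 <= INR x) -> 128 / 100 * INR x <= INR y ->
  exists q, [/\ prime q, (x < q)%N & (q <= y)%N].
Proof.
move=> Hx Hxy.
have x0 : (0 < x)%N by case: (x) Hx => //=; lra.
have xy : (x <= y)%N by apply/leP/INR_le; lra.
case: (boolP (has (fun q => prime q && (x < q)) (iota 0 y.+1))%N) => [/hasP[q]|/hasPn no].
  by rewrite mem_iota => /andP[_ qy] /andP[q_pr xq]; exists q.
exfalso.
have E : primorial y = primorial x.
  apply: primorial_eq => // q q_pr xq; rewrite ltnNge; apply/negP => qy.
  by have := no q; rewrite mem_iota q_pr xq add0n ltnS qy => /(_ isT).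
have E30 : INR 30 = 30 by rewrite INR_IZR_INZ; congr IZR.
have y30 : (30 <= y)%N by apply/leP/INR_le; rewrite E30; lra.
have lo := theta_ge _ y30; have hi := theta_le _ x0; rewrite /theta E in lo hi.
have lxy := ln_le_INR _ _ x0 xy.
set z := sqrt (INR y) in lo.
have zz : z * z = INR y by apply: sqrt_sqrt; lra.
have z0 : 0 <= z by apply: sqrt_pos.
have z1 : 1900 <= z by nra.
have lz : ln (INR y) <= 2 * (z / 700 + 6).
  rewrite -zz ln_mult; try lra.
  by have := ln_le_linear z ltac:(lra); lra.
have : z * ln (INR y) <= z * (2 * (z / 700 + 6)) by exact: Rmult_le_compat_l z0 lz.
nra.
Qed.

(** * The least failure of Robin's inequality *)

Lemma ln_le_harmonic N : ln (INR N + 2) <= sum_f_R0 (fun k => / INR (k + 1)) N.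
Proof.
elim: N => [|N IH].
  have -> : sum_f_R0 (fun k => / INR (k + 1)) 0 = 1 by rewrite /= Rinv_1.
  have := ln_tangent 1 (INR 0 + 2) ltac:(lra) ltac:(simpl; lra); rewrite ln_1 /=; lra.
have N0 := pos_INR N; rewrite tech5 addn1 !S_INR.
have := ln_tangent (INR N + 2) (INR N + 1 + 2) ltac:(lra) ltac:(lra).
replace ((INR N + 1 + 2 - (INR N + 2)) / (INR N + 2)) with (/ (INR N + 1 + 1)).
  by lra.
by field; lra.
Qed.

Lemma euler_gamma_ge0 : 0 <= euler_gamma.
Proof.
have : Rbar_le 0 (Lim_seq harmonic_minus_log).
  rewrite -(Lim_seq_const 0); apply: Lim_seq_le_loc; exists 0%N => N _; rewrite /harmonic_minus_log.
  have N0 := pos_INR N; have := ln_le_harmonic N.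
  have : ln (INR (N + 1)) <= ln (INR N + 2) by rewrite addn1 S_INR; apply: ln_le; lra.
  lra.
(* [real] sends an infinite limit to 0, so every case gives a nonnegative value. *)
by rewrite /euler_gamma; case: (Lim_seq _) => //=; lra.
Qed.

Lemma exp_euler_gamma_ge1 : 1 <= exp euler_gamma.
Proof. by have := exp_ineq1_le euler_gamma; have := euler_gamma_ge0; lra. Qed.

Definition least_robin_failure n :=
  [/\ (5040 < n)%N, robin_fails n &
      forall m, (5040 < m)%N -> (m < n)%N -> ~ robin_fails m].

Lemma ln_gt1 n : (3 < n)%N -> 1 < ln (INR n).
Proof.
move=> n3; rewrite -(ln_exp 1); apply: ln_increasing; first exact: exp_pos.
apply: Rle_lt_trans exp_le_3 _.
by have := ltn_INR _ _ n3; rewrite [INR 3]INR_IZR_INZ.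
Qed.

(* Concavity of [ln] at [ln n] turns minimality into a lower bound for the loss in
   [sigma n / n] caused by passing from [n] to a smaller number. *)
Lemma least_robin_failure_gap n m : least_robin_failure n -> (5040 < m)%N -> (m < n)%N ->
  INR (sigma m) * INR n <
  INR (sigma n) * INR m *
    (1 - (ln (INR n) - ln (INR m)) / (ln (INR n) * ln (ln (INR n)))).
Proof.
case=> _ fails_n least m_large ltmn; have /Rnot_ge_lt := least m m_large ltmn.
move: fails_n; rewrite /robin_fails => /Rge_le.
have N1' : 1 < ln (INR m) by apply: ln_gt1; apply: leq_trans m_large.
have N1 : 1 < ln (INR n) by apply: ln_gt1; apply: ltn_trans ltmn; apply: leq_trans m_large.
have m0 : 0 < INR m by apply: INR_gt0; apply: leq_trans m_large.
have n0 : 0 < INR n by apply: INR_gt0; apply: leq_ltn_trans ltmn.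
have tan := ln_tangent (ln (INR n)) (ln (INR m)) ltac:(lra) ltac:(lra).
have E0 := exp_pos euler_gamma.
set N := ln (INR n) in N1 tan *; set N' := ln (INR m) in N1' tan *.
have lN : 0 < ln N by rewrite -ln_1; apply: ln_increasing; lra.
have lN' : 0 < ln N' by rewrite -ln_1; apply: ln_increasing; lra.
move: (exp euler_gamma) E0 => E E0 Hn Hm.
apply: (Rmult_lt_reg_r (ln N)) => //.
have -> : INR (sigma n) * INR m * (1 - (N - N') / (N * ln N)) * ln N =
  INR (sigma n) * INR m * (ln N + (N' - N) / N) by field; lra.
apply: Rlt_le_trans (_ : INR (sigma n) * INR m * ln N' <= _); last first.
  by apply: Rmult_le_compat_l => //; apply: Rmult_le_pos; [exact: pos_INR | lra].
(* Robin's inequality at [m] brings in the factor [E] and its failure at [n] absorbs it. *)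
apply: Rlt_le_trans (_ : E * INR m * ln N' * INR n * ln N <= _).
  by do 2 (apply: Rmult_lt_compat_r => //).
have -> : E * INR m * ln N' * INR n * ln N = (E * INR n * ln N) * (INR m * ln N') by ring.
rewrite (Rmult_assoc (INR (sigma n))); apply: Rmult_le_compat_r => //.
by apply: Rmult_le_pos; lra.
Qed.

(** Needed before minimality can be applied at [n %/ p]. If [n %/ p <= 5040 < 2 ^ 13], then
    [sigma (n %/ p)] is at most 13 times [n %/ p]; restoring [p] at most doubles the ratio, so
    [sigma n <= 26 * n], against [ln ln n > 26]. *)
Lemma least_robin_failure_div_large n p : least_robin_failure n ->
  26 < ln (ln (INR n)) -> prime p -> (p %| n)%N -> (5040 < n %/ p)%N.
Proof.
case=> n_large fails_n _ lln p_pr pn; rewrite ltnNge; apply/negP => le_k.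
have n0 : (0 < n)%N by apply: leq_ltn_trans n_large.
have p0 := prime_gt0 p_pr.
have k0 : (0 < n %/ p)%N by rewrite divn_gt0 // dvdn_leq.
have sk : (sigma (n %/ p) <= 13 * (n %/ p))%N.
  by apply: sigma_le_log => //; apply: leq_ltn_trans le_k _.
have sn : (sigma n <= 26 * n)%N.
  have a0 : (0 < p ^ logn p n)%N by rewrite expn_gt0 p0.
  rewrite -(leq_pmul2l a0); apply: leq_trans (sigma_div_prime n p p_pr n0 pn) _.
  have psk : (p * sigma (n %/ p) <= 13 * n)%N.
    by rewrite -[X in (_ <= 13 * X)%N](divnK pn) mulnA mulnC leq_mul2r sk orbT.
  apply: leq_trans (leq_mul (_ : _ <= 2 * p ^ logn p n)%N psk) _; first by lia.
  by move: (p ^ _)%N => x; nia.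
have := Rge_le _ _ fails_n; have := leq_INR _ _ sn; rewrite INR_muln.
have -> : INR 26 = 26 by rewrite INR_IZR_INZ.
have := exp_euler_gamma_ge1; have := INR_gt0 _ n0.
move: (exp euler_gamma) (INR n) (ln _) lln => E x l l26 x0 E1 h1 h2.
have : x * 26 < x * l by apply: Rmult_lt_compat_l.
have : 1 * (x * l) <= E * (x * l).
  by apply: Rmult_le_compat_r => //; apply: Rmult_le_pos; lra.
lra.
Qed.

(** With [x = p ^ logn p n], [sigma_div_prime] and the gap at [n %/ p] give
    [1 < (1 + 1 / x) * (1 - ln p / L)]. *)
Lemma least_robin_failure_prime_power n p : least_robin_failure n ->
  26 < ln (ln (INR n)) -> prime p -> (p %| n)%N ->
  INR (p ^ logn p n) * ln (INR p) < ln (INR n) * ln (ln (INR n)).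
Proof.
move=> least lln p_pr pn.
have k_large := least_robin_failure_div_large _ _ least lln p_pr pn.
have n0 : (0 < n)%N by case: least => h _ _; apply: leq_ltn_trans h.
have k0 : (0 < n %/ p)%N by apply: leq_ltn_trans k_large.
have p0 := prime_gt0 p_pr.
have ltkn : (n %/ p < n)%N by rewrite ltn_Pdiv // prime_gt1.
have gap := least_robin_failure_gap _ _ least k_large ltkn.
have N1 : 1 < ln (INR n).
  by apply: ln_gt1; case: least => h _ _; apply: leq_ltn_trans h.
have := leq_INR _ _ (sigma_div_prime n p p_pr n0 pn).
rewrite !INR_muln S_INR; have sn0 := INR_gt0 _ (sigma_gt0 _ n0).
have x0 : 0 < INR (p ^ logn p n) by apply: INR_gt0; rewrite expn_gt0 p0.
have nE : INR n = INR (n %/ p) * INR p by rewrite -INR_muln divnK.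
have k0' := INR_gt0 _ k0; have p0' := INR_gt0 _ p0.
have d : ln (INR n) - ln (INR (n %/ p)) = ln (INR p) by rewrite nE ln_mult //; lra.
rewrite {}d {1}nE in gap.
set L := ln (INR n) * _ in gap *.
have L0 : 0 < L by apply: Rmult_lt_0_compat; lra.
move: (INR (p ^ _)) x0 => x x0 le.
set sn := INR (sigma n) in gap sn0 le; set sk := INR (sigma _) in gap le.
have {}gap : sk * INR p < sn * (1 - ln (INR p) / L).
  apply: (Rmult_lt_reg_r (INR (n %/ p))) => //; lra.
have h : (x + 1) * (sk * INR p) < (x + 1) * (sn * (1 - ln (INR p) / L)).
  by apply: Rmult_lt_compat_l => //; lra.
have {h}h : sn * x < sn * ((x + 1) * (1 - ln (INR p) / L)) by lra.
have {}h := Rmult_lt_reg_l _ _ _ sn0 h.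
have lp : 0 <= ln (INR p) / L.
  apply: Rmult_le_pos; last exact/Rlt_le/Rinv_0_lt_compat.
  by rewrite -ln_1; apply: ln_le; [lra | apply: (leq_INR 1 p)].
have {h}h : x * (ln (INR p) / L) < 1 by nra.
have -> : x * ln (INR p) = x * (ln (INR p) / L) * L by field; lra.
by rewrite -[X in _ < X]Rmult_1_l; apply: Rmult_lt_compat_r.
Qed.

Lemma sqrt_ln_growth N : 20000000000000 <= N ->
  sqrt (2 * (N * ln N)) * ln (2 * (N * ln N)) <= N / 100.
Proof.
(* With [y = N ^ (1/16)] and [ln N <= 8 y ^ 2], the product is at most [64 y ^ 11]. This is below
   [y ^ 16 / 100] because [y >= 6] and 6 ^ 5 > 6400. *)
move=> N_large; pose y := exp (ln N / 16).
have y0 : 0 < y by exact: exp_pos.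
have yN : y ^ 16 = N.
  rewrite -exp_INR_mul -[RHS]exp_ln; last by lra.
  by congr exp; rewrite INR_IZR_INZ /=; field.
have y6 : 6 <= y.
  apply: Rnot_lt_le => y6; have := pow_incr y 6 16 ltac:(lra); rewrite yN; lra.
have lN1 : ln N <= N / 2.
  by have := ln_le_linear N ltac:(lra); lra.
have lN2 : ln N <= 8 * y ^ 2.
  have -> : ln N = 8 * (2 * ln y) by rewrite /y ln_exp; field.
  have -> : 2 * ln y = ln (y ^ 2) by rewrite ln_pow //=; lra.
  have y2 : 0 < y ^ 2 by apply: pow_lt.
  by have := ln_tangent 1 (y ^ 2) ltac:(lra) y2; rewrite ln_1; lra.
have lN0 : 1 < ln N.
  rewrite -(ln_exp 1); apply: ln_increasing; first exact: exp_pos.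
  by have := exp_le_3; lra.
have L0 : 0 < N * ln N by apply: Rmult_lt_0_compat; lra.
have H1 : sqrt (2 * (N * ln N)) <= 4 * y ^ 9.
  rewrite -(sqrt_pow2 (4 * y ^ 9)); last by apply: Rmult_le_pos; [lra | apply/Rlt_le/pow_lt].
  apply: sqrt_le_1_alt; rewrite -{1}yN.
  have -> : (4 * y ^ 9) ^ 2 = 2 * (y ^ 16 * (8 * y ^ 2)) by ring.
  apply: Rmult_le_compat_l; first by lra.
  by apply: Rmult_le_compat_l => //; apply/Rlt_le/pow_lt.
have H2 : ln (2 * (N * ln N)) <= 2 * ln N.
  have -> : 2 * ln N = ln (N * N) by rewrite ln_mult; lra.
  by apply: ln_le; [lra | nra].
have H3 : ln (2 * (N * ln N)) <= 16 * y ^ 2 by lra.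
have H0 : 0 <= ln (2 * (N * ln N)) by rewrite -ln_1; apply: ln_le; nra.
apply: Rle_trans (_ : 4 * y ^ 9 * (16 * y ^ 2) <= _).
  by apply: Rmult_le_compat => //; exact: sqrt_pos.
rewrite -yN.
have y5 : 6 ^ 5 <= y ^ 5 by apply: pow_incr; lra.
have y11 : 0 < y ^ 11 by apply: pow_lt.
have -> : 4 * y ^ 9 * (16 * y ^ 2) = y ^ 11 * 64 by ring.
have -> : y ^ 16 / 100 = y ^ 11 * (y ^ 5 / 100) by field.
by apply: Rmult_le_compat_l; lra.
Qed.

Lemma ln_ln_gt26 N : 20000000000000 <= N -> 26 < ln N.
Proof.
move=> N_large; rewrite -(ln_exp 26); apply: ln_increasing; first exact: exp_pos.
have -> : 26 = INR 26 * 1 by rewrite INR_IZR_INZ /=; lra.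
rewrite exp_INR_mul; apply: Rle_lt_trans (_ : 3 ^ 26 < _); last by lra.
by apply: pow_incr; split; [exact/Rlt_le/exp_pos | exact: exp_le_3].
Qed.

(** Prime powers in [n] are at most [L2], and primes above [sqrt L2] occur at most once, so [ln n]
    exceeds [theta P] by at most [sqrt L2 * ln L2], which is at most one percent of [ln n]. *)
Lemma least_robin_failure_ln_le n P : least_robin_failure n ->
  20000000000000 <= ln (INR n) ->
  (forall p, prime p -> (p %| n)%N -> (p <= P)%N) ->
  99 / 100 * ln (INR n) <= theta P.
Proof.
move=> least N_large n_le; have lln := ln_ln_gt26 _ N_large.
have grow := sqrt_ln_growth _ N_large.
have n0 : (0 < n)%N by case: least => h _ _; apply: leq_ltn_trans h.
set L2 := 2 * (ln (INR n) * ln (ln (INR n))) in grow.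
have L1 : 1 < L2 by rewrite /L2; nra.
have [B [B1 B2]] := nfloor_ex L2 ltac:(lra).
have [K [K1 K2]] := nfloor_ex (sqrt L2) (sqrt_pos L2).
have pw p : prime p -> INR (p ^ logn p n) <= L2.
  move=> p_pr; case: (boolP (p %| n)%N) => pn; last first.
    have -> : logn p n = 0%N by rewrite lognE (negbTE pn) !andbF.
    by rewrite expn0 /=; lra.
  have := least_robin_failure_prime_power _ _ least lln p_pr pn.
  (* This bound is the origin of the factor 2 in [L2]. *)
  have lp : / 2 < ln (INR p).
    apply: Rlt_le_trans ln_lt_2 _; apply: ln_le; first by lra.
    by have := leq_INR _ _ (prime_gt1 p_pr).
  have x0 := pos_INR (p ^ logn p n).
  rewrite /L2; nra.
have B0 : (0 < B)%N.
  by rewrite lt0n; apply/eqP => B0; rewrite B0 /= in B2; lra.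
have le : (n <= primorial P * B ^ K)%N.
  apply: leq_primorial_mul_exp => // p p_pr.
    rewrite leqNgt; apply/negP => /leq_INR; rewrite S_INR.
    by have := pw p p_pr; lra.
  move=> Kp; rewrite leqNgt; apply/negP => a2.
  have h := pw p p_pr.
  have : INR (p ^ 2) <= L2.
    by apply: Rle_trans h; apply: leq_INR; rewrite leq_pexp2l // prime_gt0.
  rewrite INR_expn => h2.
  have : INR p <= sqrt L2.
    by rewrite -(sqrt_pow2 (INR p)); [apply: sqrt_le_1_alt | apply: pos_INR].
  by have := leq_INR _ _ Kp; rewrite S_INR; lra.
have := ln_le_INR _ _ n0 le.
rewrite ln_INR_muln ?primorial_gt0 ?expn_gt0 ?B0 // INR_expn ln_pow; last exact: INR_gt0.
have : INR K * ln (INR B) <= sqrt L2 * ln L2.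
  apply: Rmult_le_compat => //; first exact: pos_INR.
    by rewrite -ln_1; apply: ln_le; [lra | apply: (leq_INR 1 B)].
  by apply: ln_le => //; exact: INR_gt0.
rewrite /theta; lra.
Qed.

(* Compare [n = k q P] with [k q^2]. *)
Lemma least_robin_failure_swap n q P : least_robin_failure n ->
  26 < ln (ln (INR n)) -> prime q -> prime P -> (q < P)%N ->
  logn q n = 1%N -> logn P n = 1%N ->
  INR q * (INR q + 1) * (INR P + 1) *
    ((ln (INR P) - ln (INR q)) / (ln (INR n) * ln (ln (INR n)))) <
  INR q * (INR q + 1) - INR P.
Proof.
move=> least lln q_pr P_pr qP qn Pn.
have n0 : (0 < n)%N by case: least => h _ _; apply: leq_ltn_trans h.
have P_dvd : (P %| n)%N.
  by have := pfactor_dvdnn P n; rewrite Pn expn1.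
have k_large := least_robin_failure_div_large _ _ least lln P_pr P_dvd.
have [m Pm nE] := pfactor_coprime P_pr n0; rewrite Pn expn1 in nE.
have m0 : (0 < m)%N by move: n0; rewrite nE muln_gt0 => /andP[].
have P0 := prime_gt0 P_pr; have q0 := prime_gt0 q_pr.
have qP' : logn q P = 0%N by rewrite logn_prime //; case: eqP qP => // ->; rewrite ltnn.
have qm : logn q m = 1%N by move: qn; rewrite nE lognM // qP' addn0.
have [k qk mE] := pfactor_coprime q_pr m0; rewrite qm expn1 in mE.
have k0 : (0 < k)%N by move: m0; rewrite mE muln_gt0 => /andP[].
have q_k : ~~ (q %| k)%N by rewrite -prime_coprime.
have P_m : ~~ (P %| m)%N by rewrite -prime_coprime.
have sn : sigma n = (P.+1 * (q.+1 * sigma k))%N.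
  by rewrite nE sigma_mul_prime // mE sigma_mul_prime.
have sn' := @sigma_mul_prime2 k q q_pr k0 q_k.
have n'_large : (5040 < k * q ^ 2)%N.
  apply: leq_trans k_large _; rewrite nE mulnK // mE -mulnn mulnA.
  by rewrite -[X in (X <= _)%N]muln1 leq_mul2l q0 orbT.
have ltn' : (k * q ^ 2 < n)%N.
  by rewrite nE mE -mulnn mulnA ltn_mul2l qP muln_gt0 k0 q0.
have gap := least_robin_failure_gap _ _ least n'_large ltn'.
have nE' : INR n = INR k * INR q * INR P by rewrite nE mE !INR_muln.
have k0' := INR_gt0 _ k0; have q0' := INR_gt0 _ q0; have P0' := INR_gt0 _ P0.
have kq0 : 0 < INR k * INR q by apply: Rmult_lt_0_compat.
have d : ln (INR n) - ln (INR (k * q ^ 2)) = ln (INR P) - ln (INR q).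
  rewrite nE' -mulnn !INR_muln !ln_mult //; first by ring.
  by apply: Rmult_lt_0_compat.
rewrite {}d {}sn {}sn' {1}nE' in gap.
move: gap; rewrite !INR_muln !plus_INR INR_expn !S_INR /=.
set t := (_ - _) / _; have s0 := INR_gt0 _ (sigma_gt0 _ k0).
move: (INR (sigma k)) s0 => s s0 gap.
(* Cancelling this common factor leaves [(q^2 + q + 1) P < (P + 1) q (q + 1) (1 - t)], which
   rearranges to the claim. *)
have c0 : 0 < s * (INR k * INR q) by apply: Rmult_lt_0_compat.
apply: (Rmult_lt_reg_l _ _ _ c0).
lra.
Qed.

(** * Prime indices and the final numerical comparison *)

Lemma count_prime_lt p q : prime q -> (p < q)%N ->
  (count prime (iota 0 p.+1) < count prime (iota 0 q.+1))%N.
Proof.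
move=> q_pr pq; have -> : q.+1 = (p.+1 + (q - p))%N by lia.
rewrite iotaD count_cat -[X in (X < _)%N]addn0 ltn_add2l -has_count.
by apply/hasP; exists q => //; rewrite mem_iota; lia.
Qed.

Lemma count_prime_le p q : (p <= q)%N ->
  (count prime (iota 0 p.+1) <= count prime (iota 0 q.+1))%N.
Proof.
move=> pq; have -> : q.+1 = (p.+1 + (q - p))%N by lia.
by rewrite iotaD count_cat leq_addr.
Qed.

(** Because [exp 2 <= 9 < 10]. With [K = 10 ^ 13] this gives the threshold 20000000000000 for
    [ln n]. *)
Lemma ln_gt_exp10 n K : (10 ^ K < n)%N -> 2 * INR K <= ln (INR n).
Proof.
move=> ltn; have h := ltn_INR _ _ ltn; rewrite INR_expn in h.
have -> : 2 * INR K = ln (exp (INR K * 2)) by rewrite ln_exp; ring.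
apply: ln_le; first exact: exp_pos.
apply: Rle_trans (Rlt_le _ _ h); rewrite exp_INR_mul; apply: pow_incr.
split; first exact/Rlt_le/exp_pos.
have -> : 2 = 1 + 1 by lra.
rewrite exp_plus; have -> : INR 10 = 10 by rewrite INR_IZR_INZ.
by have := exp_le_3; have := exp_pos 1; nra.
Qed.

Lemma least_robin_failure_ln_le_prime n P : least_robin_failure n ->
  20000000000000 <= ln (INR n) ->
  prime P -> (forall p, prime p -> (p %| n)%N -> (p <= P)%N) ->
  16000000000000 <= INR P /\ ln (INR n) <= 115 / 100 * INR P.
Proof.
move=> least N_large P_pr n_le.
have := least_robin_failure_ln_le _ _ least N_large n_le.
have := theta_le _ (prime_gt0 P_pr); have P0 := INR_gt0 _ (prime_gt0 P_pr).
have l1 := ln_le_linear _ P0.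
have w0 := sqrt_lt_R0 _ P0; set w := sqrt _ in w0.
have ww : w * w = INR P by apply: sqrt_sqrt; lra.
have l2 : ln (INR P) <= 2 * (w / 700 + 6).
  rewrite -ww ln_mult //; have := ln_le_linear _ w0; lra.
(* The linear bound [l1] on [ln P] suffices for the size of [P]; the sharper [l2] then gives the
   ratio, since 1.131 / 0.99 < 1.15. *)
move=> h1 h2; have P_large : 16000000000000 <= INR P by lra.
split=> //; have w_large : 4000000 <= w by nra.
have : 37 * (2 * (w / 700 + 6)) + 200 <= w * w / 1000 by nra.
lra.
Qed.

Lemma exists_prime_sqrt P : 16000000000000 <= P ->
  exists q, [/\ prime q, sqrt P < INR q & INR q <= 129 / 100 * sqrt P].
Proof.
move=> P_large; have w0 := sqrt_pos P; set w := sqrt P in w0 *.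
have ww : w * w = P by apply: sqrt_sqrt; lra.
have w_large : 4000000 <= w by nra.
have [x [x1 x2]] := nfloor_ex w w0.
(* Raising 1.28 to 1.29 absorbs the rounding to integers. *)
have [y [y1 y2]] := nfloor_ex (129 / 100 * w) ltac:(lra).
have [|| q [q_pr xq qy]] := exists_prime_between x y; [lra | lra |].
exists q; split=> //; have := leq_INR _ _ xq; have := leq_INR _ _ qy; rewrite ?S_INR; lra.
Qed.

Lemma swap_loses P q N : 16000000000000 <= P -> 1 < N -> N <= 115 / 100 * P ->
  sqrt P < q -> q <= 129 / 100 * sqrt P ->
  q * (q + 1) - P <= q * (q + 1) * (P + 1) * ((ln P - ln q) / (N * ln N)).
Proof.
move=> P_large N1 NP q_lo q_hi; have w0 : 0 < sqrt P by apply: sqrt_lt_R0; lra.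
set w := sqrt P in w0 q_lo q_hi.
have ww : w * w = P by apply: sqrt_sqrt; lra.
have w_large : 4000000 <= w by nra.
have lP : 24 <= ln P.
  rewrite -(ln_exp 24); apply: ln_le; first exact: exp_pos.
  have -> : 24 = INR 24 * 1 by rewrite INR_IZR_INZ /=; lra.
  rewrite exp_INR_mul; apply: Rle_trans (_ : 3 ^ 24 <= _); last by lra.
  by apply: pow_incr; split; [exact/Rlt_le/exp_pos | exact: exp_le_3].
have lq : ln q <= ln P / 2 + 29 / 100.
  have -> : ln P = 2 * ln w by rewrite -ww ln_mult //; ring.
  have := ln_tangent w q w0 ltac:(lra).
  have : (q - w) / w <= 29 / 100.
    apply: (Rmult_le_reg_r w) => //; rewrite /Rdiv Rmult_assoc Rinv_l; lra.
  lra.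
have lN0 : 0 < ln N by rewrite -ln_1; apply: ln_increasing; lra.
have lN : ln N <= ln P + 15 / 100.
  apply: Rle_trans (_ : ln (115 / 100 * P) <= _); first by apply: ln_le; lra.
  rewrite ln_mult; try lra.
  by have := ln_tangent 1 (115 / 100) ltac:(lra) ltac:(lra); rewrite ln_1; lra.
have L0 : 0 < N * ln N by apply: Rmult_lt_0_compat; lra.
have L_le : N * ln N <= 115 / 100 * P * (ln P + 15 / 100).
  by apply: Rmult_le_compat; lra.
set t := (ln P - ln q) / (N * ln N).
have tE : t * (N * ln N) = ln P - ln q by rewrite /t; field; lra.
(* The extreme case is [ln P = 24]: (12 - 0.29) / (1.15 * 24.15) > 0.42. *)
have t_ge : 42 / 100 <= t * P.
  apply: Rnot_lt_le => t_lt.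
  have t0 : 0 < t.
    by apply: Rdiv_lt_0_compat => //; lra.
  have : t * (N * ln N) <= t * (115 / 100 * P * (ln P + 15 / 100)).
    by apply: Rmult_le_compat_l; lra.
  have : t * P * (115 / 100 * (ln P + 15 / 100)) <= 42 / 100 * (115 / 100 * (ln P + 15 / 100)).
    by apply: Rmult_le_compat_r; lra.
  lra.
have t0 : 0 <= t by apply: Rmult_le_pos; [lra | exact/Rlt_le/Rinv_0_lt_compat].
have Q0 : 0 <= q * (q + 1) by nra.
(* Here 1.29 ^ 2 = 1.6641, and the conclusion follows from (1 - 0.42) * 1.67 < 1. *)
have Q_le : q * (q + 1) <= 167 / 100 * P by rewrite -ww; nra.
have : q * (q + 1) * (42 / 100) <= q * (q + 1) * (t * P + t).
  by apply: Rmult_le_compat_l; lra.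
lra.
Qed.

(* n = prod_{i=1}^r p_i^{a_i} with a_i = logn p_i n; p_r = largest prime divisor;
   s = largest index <= r with a_s <> 1. *)
Theorem theorem6 (n r s pr ps : nat)
  (Hn5040 : (5040 < n)%N)
  (Hfail : robin_fails n)
  (Hleast : forall m : nat, (5040 < m)%N -> (m < n)%N -> ~ robin_fails m)
  (Hbig : (10 ^ (10 ^ 13) < n)%N)
  (Hpr : is_nth_prime r pr) (Hlpd : largest_prime_divisor n pr)
  (Hs1 : (1 <= s)%N) (Hsr : (s <= r)%N) (Hps : is_nth_prime s ps)
  (Has : logn ps n <> 1%N)
  (Hmax : forall j p : nat, (s < j)%N -> (j <= r)%N -> is_nth_prime j p ->
            logn p n = 1%N) :
  Rgt (INR ps) (Rmult (Rdiv (IZR 999999) (IZR 1000000)) (sqrt (INR pr))).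
Proof.
have least : least_robin_failure n by split.
have N_large : 20000000000000 <= ln (INR n).
  move: (ln_gt_exp10 _ _ Hbig); rewrite INR_expn.
  have -> : INR 10 = 10 by rewrite INR_IZR_INZ.
  lra.
have lln := ln_ln_gt26 _ N_large.
case: Hpr => pr_prime pr_index; case: Hlpd => _ [_ pr_max].
case: Hps => ps_prime ps_index.
have [P_large N_le] := least_robin_failure_ln_le_prime _ _ least N_large pr_prime pr_max.
apply: Rnot_le_gt => ps_small.
have [q [q_prime q_lo q_hi]] := exists_prime_sqrt _ P_large.
have w0 := sqrt_pos (INR pr).
have ww : sqrt (INR pr) * sqrt (INR pr) = INR pr by apply: sqrt_sqrt; lra.
have psq : (ps < q)%N by apply/ltP/INR_lt; lra.
have qpr : (q < pr)%N by apply/ltP/INR_lt; nra.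
(* Maximality of [s] concerns indices; counting primes transfers it to every prime in the interval
   from [ps] (excluded) to [pr], in particular to [q] and [pr]. *)
have exp1 p : prime p -> (ps < p)%N -> (p <= pr)%N -> logn p n = 1%N.
  move=> p_prime psp ppr; apply: (Hmax (count prime (iota 0 p.+1))) => //.
    by rewrite -ps_index; exact: count_prime_lt.
  by rewrite -pr_index; exact: count_prime_le.
have := least_robin_failure_swap _ _ _ least lln q_prime pr_prime qpr
  (exp1 _ q_prime psq (ltnW qpr)) (exp1 _ pr_prime (ltn_trans psq qpr) (leqnn _)).
have := swap_loses _ _ (ln (INR n)) P_large ltac:(lra) N_le q_lo q_hi.
lra.
Qed.
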